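(* Let $X,Y$ be Banach spaces over $\mathbb{K}\in\{\mathbb{R},\mathbb{C}\}$ and let $G\in L(X,Y)$ with $\|G\|=1$, and assume $\|\cdot\|_G$ is a norm on $L(X,Y)$. Let \[ C :=\Bigl\{ \psi \in B_{L(X,Y)^*} : \exists\ \text{a net}\ (x_\alpha, y_\alpha^* ) \subset S_X \times S_{Y^*} \text{ with } \|Gx_\alpha\|\to 1 \text{ and } \psi_{x_\alpha, y_\alpha^*} \xrightarrow{w^*} \psi\Bigr\}. \] Then the closed unit ball of the dual of $(L(X,Y),\|\cdot\|_G)$ satisfies $B_{(L(X,Y),\|\cdot\|_G)^*} = \overline{\operatorname{co}}^{\,w^*}(C)$, the weak*-closed convex hull of $C$.
   Context: $S_X$ is the unit sphere of $X$, $Y^*$ the dual of $Y$, $B_{L(X,Y)^*}$ the closed unit ball of the dual of $L(X,Y)$ with the operator norm; $w^*$ denotes the weak* topology (induced by $L(X,Y)$). For $x\in X$, $y^*\in Y^*$, $\psi_{x,y^*}(S)=y^*(Sx)$ for $S\in L(X,Y)$. The $G$-norm is $\|T\|_G := \inf_{\delta>0}\sup\{\|Tx\|: x\in S_X,\ \|Gx\|>1-\delta\}$. *)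

(* Defs.v *)
(* Scalars: an arbitrary numFieldType K in the
   definitions; the theorem instantiates K with R and with R[i] (R : realType). *)
From mathcomp Require Import all_boot all_algebra.
From mathcomp Require Import all_classical all_reals all_analysis.
From mathcomp Require Export complex.
From mathcomp Require Import order ssralg ssrnum.
Import Order.TTheory GRing.Theory Num.Theory.
Import numFieldNormedType.Exports.
Local Open Scope classical_set_scope.
Local Open Scope ring_scope.

Set Implicit Arguments.
Unset Strict Implicit.
Unset Printing Implicit Defensive.

Section Defs.
Variable K : numFieldType.

(* supremum / infimum of a set of scalars (all sets used below consist of
   real numbers, i.e. norms); [supK A] is the least upper bound when it exists *)
Definition is_sup (A : set K) (s : K) : Prop :=
  (forall a, A a -> a <= s) /\ (forall e : K, 0 < e -> exists2 a, A a & s - e < a).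
Definition is_inf (A : set K) (s : K) : Prop :=
  (forall a, A a -> s <= a) /\ (forall e : K, 0 < e -> exists2 a, A a & a < s + e).
Definition supK (A : set K) : K := xget 0 [set s | is_sup A s].
Definition infK (A : set K) : K := xget 0 [set s | is_inf A s].

Section Spaces.
Variables X Y : normedModType K.

Definition unit_sphere : set X := [set x | `|x| = 1].

Definition bounded_linear (T : X -> Y) : Prop :=
  (forall (a : K) (u v : X), T (a *: u + v) = a *: T u + T v) /\
  (exists M : K, forall x, `|T x| <= M * `|x|).
Definition Lop : set (X -> Y) := [set T | bounded_linear T].

Definition opnorm (T : X -> Y) : K := supK [set `|T x| | x in [set x : X | `|x| <= 1]].

Definition gnorm (G T : X -> Y) : K :=
  infK [set supK [set `|T x| | x in [set x | unit_sphere x /\ 1 - d < `|G x|]]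
       | d in [set d : K | 0 < d]].

Definition gnorm_is_norm (G : X -> Y) : Prop :=
  forall (S T : X -> Y) (a : K), Lop S -> Lop T ->
    [/\ 0 <= gnorm G S,
        gnorm G S = 0 -> S = (fun _ => 0),
        gnorm G (fun x => a *: S x) = `|a| * gnorm G S &
        gnorm G (fun x => S x + T x) <= gnorm G S + gnorm G T].

(* functionals on L(X,Y) are represented as maps (X -> Y) -> K; only their
   values on Lop matter *)
Definition lin_on_L (psi : (X -> Y) -> K) : Prop :=
  forall (a : K) (S T : X -> Y), Lop S -> Lop T ->
    psi (fun x => a *: S x + T x) = a * psi S + psi T.

Definition dualL (psi : (X -> Y) -> K) : Prop :=
  lin_on_L psi /\ exists M : K, forall S, Lop S -> `|psi S| <= M * opnorm S.

Definition dual_ball (psi : (X -> Y) -> K) : Prop :=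
  lin_on_L psi /\ forall S, Lop S -> `|psi S| <= opnorm S.

Definition dual_ball_G (G : X -> Y) : set ((X -> Y) -> K) :=
  [set psi | lin_on_L psi /\ forall S, Lop S -> `|psi S| <= gnorm G S].

Definition dnorm (f : Y -> K) : K := supK [set `|f y| | y in [set y : Y | `|y| <= 1]].
Definition dual_sphere (f : Y -> K) : Prop :=
  (forall (a : K) (u v : Y), f (a *: u + v) = a * f u + f v) /\
  (exists M : K, forall y, `|f y| <= M * `|y|) /\ dnorm f = 1.

Definition psi_xy (x : X) (f : Y -> K) : (X -> Y) -> K := fun S => f (S x).

Definition directed_le (I : Type) (le : I -> I -> Prop) : Prop :=
  (exists i : I, True) /\ (forall i, le i i) /\
  (forall i j k, le i j -> le j k -> le i k) /\
  (forall i j, exists k, le i k /\ le j k).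
Definition net_cvg (I : Type) (le : I -> I -> Prop) (u : I -> K) (l : K) : Prop :=
  forall e : K, 0 < e -> exists i0, forall i, le i0 i -> `|u i - l| < e.

Definition Cset (G : X -> Y) : set ((X -> Y) -> K) :=
  [set psi | dual_ball psi /\
    exists (I : Type) (le : I -> I -> Prop) (x : I -> X) (y : I -> Y -> K),
      [/\ directed_le le,
          forall i, unit_sphere (x i) /\ dual_sphere (y i),
          net_cvg le (fun i => `|G (x i)|) 1 &
          forall S, Lop S -> net_cvg le (fun i => psi_xy (x i) (y i) S) (psi S)]].

Definition conv_hull (A : set ((X -> Y) -> K)) : set ((X -> Y) -> K) :=
  [set psi | exists (n : nat) (lam : 'I_n -> K) (phi : 'I_n -> (X -> Y) -> K),
     [/\ forall i, 0 <= lam i, \sum_(i < n) lam i = 1, forall i, A (phi i) &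
         psi = (fun S => \sum_(i < n) lam i * phi i S)]].

(* weak*-closure in L(X,Y)^* (topology of pointwise convergence on L(X,Y)),
   written out through its basic neighbourhoods *)
Definition wstar_closure (A : set ((X -> Y) -> K)) : set ((X -> Y) -> K) :=
  [set psi | dualL psi /\
     forall (n : nat) (S : 'I_n -> (X -> Y)) (e : K), (forall i, Lop (S i)) -> 0 < e ->
       exists2 phi, A phi & forall i, `|phi (S i) - psi (S i)| < e].

End Spaces.
End Defs.

(* Main.v *)
(* A functional in C is bounded by the G-norm, since it is a limit of values
   y*(S x) at points x with |G x| -> 1; this bound survives convex combinations
   and weak* limits. Conversely, let psi lie in the dual ball of the G-norm and
   suppose that a basic weak* neighbourhood of psi, given by S_1, ..., S_n,
   misses co(C). Separating in K^n gives a combination T of the S_i with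
   Re phi(T) < Re psi(T) <= |T|_G for all phi in C. But there are unit vectors
   x_k with |G x_k| -> 1 and |T x_k| -> |T|_G, and norming functionals y_k of
   T x_k (Hahn-Banach); the limit of psi_{x_k, y_k} along a free ultrafilter
   lies in C and takes the value |T|_G at T, a contradiction. *)
Require Import Defs.
From mathcomp Require Import all_boot all_algebra.
From mathcomp Require Import all_classical all_reals all_analysis.
From mathcomp Require Import complex order ssralg ssrnum.
From mathcomp Require Import ring lra.
Import Order.TTheory GRing.Theory Num.Theory.
Import numFieldNormedType.Exports.
Local Open Scope classical_set_scope.
Local Open Scope ring_scope.
Local Open Scope complex_scope.

Set Implicit Arguments.
Unset Strict Implicit.
Unset Printing Implicit Defensive.

(* MathComp's monoid library has its own [gnorm]. *)
Local Notation gnorm := Defs.gnorm.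

(* The properties of the scalars used below, in a form shared by [R] and [R[i]]:
   [inc] embeds [R], [re] is the real part and [cj] the conjugation. *)
Record real_structure (R : realType) (K : numFieldType) := RealStructure {
  inc : {rmorphism R -> K};
  re : {additive K -> R};
  cj : K -> K;
  inc_ge0 : forall r, 0 <= r -> 0 <= inc r;
  re1 : re 1 = 1;
  reZ : forall r z, re (inc r * z) = r * re z;
  normE : forall z : K, `|z| = inc (re `|z|);
  re_le_norm : forall z : K, re z <= re `|z|;
  re_cjC : forall z w, re (cj z * w) = re (cj w * z);
  re_cj_norm : forall z : K, re (cj z * z) = re `|z| ^+ 2;
  re_riesz : forall g : K -> R,
    (forall r z w, g (inc r * z + w) = r * g z + g w) ->
    exists c, forall z, g z = re (z * c);
  norm_le_re : exists j, forall z : K,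
    re `|z| <= `|re z| + `|re (j * z)| }.

(** * The two scalar fields *)

Lemma real_structure_real (R : realType) : real_structure R R.
Proof.
apply: (@RealStructure R R idfun idfun id) => //=.
- exact: ler_norm.
- by move=> z w; rewrite mulrC.
- by move=> z; rewrite real_normK ?num_real// expr2.
- move=> g gE; exists (g 1) => z.
  have g0 : g 0 = 0.
    by have := gE (-1) 0 0; rewrite mulr0 addr0 mulN1r addNr.
  by have := gE z 1 0; rewrite mulr1 addr0 g0 addr0.
- by exists 0 => z; rewrite mul0r normr0 addr0.
Qed.

Lemma real_structure_complex (R : realType) : real_structure R R[i].
Proof.
have normRe (z : R[i]) : `|z| = (complex.Re `|z|)%:C by rewrite normc_def.
apply: (@RealStructure R R[i] (real_complex R) (@complex.Re R) (@conjc R)) => /=.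
- by move=> r r0; rewrite lecR.
- by [].
- by move=> r [a b] /=; rewrite mul0r subr0.
- exact: normRe.
- move=> z; rewrite (le_trans (ler_norm _))// -lecR -normRe; exact: normc_ge_Re.
- by move=> [a b] [c d] /=; ring.
- move=> z; have := add_Re2_Im2 z; rewrite normRe -rmorphXn /= => -[<-].
  by case: z => a b /=; ring.
(* The representing scalar is [g 1 - i (g i)]: the real part of [(a + i b)] times it is
   [a (g 1) + b (g i)]. *)
- move=> g gE; exists (g 1 +i* - g 'i) => -[a b].
  have g0 : g 0 = 0.
    by have := gE (-1) 0 0; rewrite mulr0 addr0 mulN1r addNr.
  have -> : a +i* b = a%:C * 1 + (b%:C * 'i + 0).
    by apply/eqP; rewrite eq_complex /=; apply/andP; split; apply/eqP; ring.
  rewrite !gE g0 /=; ring.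
(* Multiplying by [i] turns the real part into minus the imaginary part, so the claim is |z| <= |Re
   z| + |Im z|, checked on squares. *)
- exists 'i => -[a b] /=.
  rewrite mul0r mul1r sub0r normrN -ler_sqr ?nnegrE ?addr_ge0 ?sqrtr_ge0//.
  rewrite sqr_sqrtr ?addr_ge0 ?sqr_ge0// -[a^+2]real_normK ?num_real//.
  rewrite -[b^+2]real_normK ?num_real//.
  have := normr_ge0 a; have := normr_ge0 b; nra.
Qed.

(** * Order and real parts of scalars *)

Section real_structure_theory.
Variables (R : realType) (K : numFieldType) (rs : real_structure R K).
Local Notation inc := (inc rs).
Local Notation re := (re rs).
Local Notation cj := (cj rs).

Lemma incK r : re (inc r) = r.
Proof. by rewrite -[inc r]mulr1 reZ re1 mulr1. Qed.

Lemma ge0_inc z : 0 <= z -> z = inc (re z).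
Proof. by move=> z0; rewrite -{1}(ger0_norm z0) (normE rs) ger0_norm. Qed.

Lemma inc_le r s : (inc r <= inc s) = (r <= s).
Proof.
apply/idP/idP => [irs|rs_le]; last first.
  by rewrite -subr_ge0 -rmorphB inc_ge0// subr_ge0.
rewrite leNgt; apply/negP => sr.
have /le_anti/(congr1 re) : inc r <= inc s <= inc r.
  by rewrite irs -subr_ge0 -rmorphB inc_ge0// subr_ge0 ltW.
by rewrite !incK => rs_eq; rewrite rs_eq ltxx in sr.
Qed.

Lemma inc_lt r s : (inc r < inc s) = (r < s).
Proof.
by rewrite !lt_neqAle inc_le (can_eq incK).
Qed.

Lemma re_ge0 z : 0 <= z -> 0 <= re z.
Proof. by move=> z0; rewrite -inc_le rmorph0 -ge0_inc. Qed.

Lemma re_gt0 z : 0 < z -> 0 < re z.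
Proof. by move=> z0; rewrite -inc_lt rmorph0 -ge0_inc// ltW. Qed.

Lemma re_le z w : 0 <= z -> z <= w -> re z <= re w.
Proof.
move=> z0 zw; rewrite -inc_le -!ge0_inc//; exact: le_trans zw.
Qed.

Lemma norm_inc r : `|inc r| = inc `|r|.
Proof.
have [r0|r0] := leP 0 r; first by rewrite !ger0_norm// inc_ge0.
by rewrite (ltr0_norm r0) -normrN -rmorphN ger0_norm// inc_ge0// oppr_ge0 ltW.
Qed.

(** Testing with [a = cj (z - w)] gives |z - w|^2 = 0. *)
Lemma re_inj z w : (forall a, re (a * z) = re (a * w)) -> z = w.
Proof.
move=> zw; apply/eqP; rewrite -subr_eq0 -normr_eq0 (normE rs).
have : re `|z - w| ^+ 2 = 0.
  by rewrite -re_cj_norm mulrBr raddfB zw subrr.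
by move=> /eqP; rewrite sqrf_eq0 => /eqP ->; rewrite rmorph0.
Qed.

(** * The Hahn-Banach theorem through minimal sublinear functionals *)

Section hahn_banach.
Variable V : lmodType K.

Definition sublinear (p : V -> R) :=
  (forall x y, p (x + y) <= p x + p y) /\
  (forall r x, 0 <= r -> p (inc r *: x) = r * p x).

Lemma sublinear0 p : sublinear p -> p 0 = 0.
Proof. by case=> _ /(_ 0 0 (lexx _)); rewrite scaler0 mul0r. Qed.

Lemma sublinear_ge p x : sublinear p -> - p (- x) <= p x.
Proof.
by move=> sp; have := sp.1 x (- x); rewrite subrr sublinear0//; lra.
Qed.

(** Serves both the shift of a functional and the lower bound of a chain. Each hypothesis asks only
    for some smaller member of the family, which is enough for the infimum. *)
Lemma sublinear_inf (E : V -> set R) :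
  (forall x, has_inf (E x)) ->
  (forall x y a b, E x a -> E y b -> exists2 c, E (x + y) c & c <= a + b) ->
  (forall r x a, 0 < r -> E x a -> exists2 c, E (inc r *: x) c & c <= r * a) ->
  E 0 0 -> (forall a, E 0 a -> 0 <= a) -> sublinear (fun x => inf (E x)).
Proof.
move=> Ei ED EZ E00 E0.
have infZ r x : 0 < r -> inf (E (inc r *: x)) <= r * inf (E x).
  move=> r0; rewrite mulrC -ler_pdivrMr//; apply: lb_le_inf; first exact: (Ei x).1.
  move=> a Ea; rewrite ler_pdivrMr// mulrC; have [c Ec ca] := EZ _ _ _ r0 Ea.
  by apply: le_trans ca; apply: ge_inf => //; exact: (Ei _).2.
split.
  move=> x y; apply/ler_addgt0Pr => e e0.
  have e2 : 0 < e / 2 by rewrite divr_gt0.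
  have [a Ea la] := inf_adherent e2 (Ei x).
  have [b Eb lb] := inf_adherent e2 (Ei y).
  have [c Ec cab] := ED _ _ _ _ Ea Eb.
  apply: (@le_trans _ _ c); first by apply: ge_inf => //; exact: (Ei _).2.
  apply: (le_trans cab); lra.
move=> r x; rewrite le_eqVlt => /orP[/eqP <-|r0].
  rewrite rmorph0 scale0r mul0r; apply/eqP; rewrite eq_le; apply/andP; split.
    by apply: ge_inf => //; exact: (Ei _).2.
  by apply: lb_le_inf => //; exists 0.
apply/eqP; rewrite eq_le infZ//= mulrC -ler_pdivlMr// mulrC.
(* The reverse inequality is [infZ] for the ratio [r^-1] at the point [inc r *: x]. *)
have r0' : 0 < r^-1 by rewrite invr_gt0.
have := infZ _ (inc r *: x) r0'.
by rewrite scalerA -rmorphM mulVf ?gt_eqF// rmorph1 scale1r.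
Qed.

Section shift.
Variables (p : V -> R) (sp : sublinear p) (y : V).

(* The infimum [q] of this family lies below [p] and satisfies
   [q (- y) <= - p y]. *)
Definition shift_family (x : V) : set R :=
  [set p (x + inc t *: y) - t * p y | t in [set t | 0 <= t]].

Lemma shift_family_has_inf x : has_inf (shift_family x).
Proof.
split; first by exists (p (x + inc 0 *: y) - 0 * p y), 0 => //=.
(* The lower bound comes from t p(y) = p(t y) <= p(x + t y) + p(-x). *)
exists (- p (- x)) => _ [t /= t0 <-].
rewrite -(sp.2 _ _ t0); have := sp.1 (x + inc t *: y) (- x).
by rewrite addrAC subrr add0r; lra.
Qed.

Definition sublinear_shift x := inf (shift_family x).

Lemma sublinear_shiftP : sublinear sublinear_shift.
Proof.
apply: sublinear_inf.
- exact: shift_family_has_inf.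
- move=> x z _ _ [s /= s0 <-] [t /= t0 <-].
  exists (p (x + z + inc (s + t) *: y) - (s + t) * p y).
    by exists (s + t) => //=; exact: addr_ge0.
  have := sp.1 (x + inc s *: y) (z + inc t *: y).
  by rewrite rmorphD scalerDl addrACA; lra.
- move=> r x _ r0 [t /= t0 <-].
  exists (p (inc r *: x + inc (r * t) *: y) - (r * t) * p y).
    by exists (r * t) => //=; rewrite mulr_ge0// ltW.
  by rewrite rmorphM -scalerA -scalerDr (sp.2 _ _ (ltW r0)) mulrBr mulrA.
- by exists 0 => //=; rewrite rmorph0 scale0r addr0 mul0r sublinear0// subr0.
- by move=> _ [t /= t0 <-]; rewrite add0r sp.2// subrr.
Qed.

Lemma sublinear_shift_le x : sublinear_shift x <= p x.
Proof.
apply: ge_inf; first exact: (shift_family_has_inf x).2.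
by exists 0 => //=; rewrite rmorph0 scale0r addr0 mul0r subr0.
Qed.

Lemma sublinear_shiftN : sublinear_shift (- y) <= - p y.
Proof.
apply: ge_inf; first exact: (shift_family_has_inf _).2.
by exists 1 => //=; rewrite rmorph1 scale1r addNr mul1r sublinear0// sub0r.
Qed.

End shift.

(* Zorn's lemma, applied to sublinear functionals rather than to partial linear
   ones: a minimal [p] equals its shift along every [y], which forces
   [p (- y) = - p y]. *)
Lemma minimal_sublinear (N : V -> R) : sublinear N ->
  exists p, [/\ sublinear p, forall x, p x <= N x &
    forall q, sublinear q -> (forall x, q x <= p x) -> q = p].
Proof.
move=> sN; pose T := {p : V -> R | sublinear p /\ forall x, p x <= N x}.
pose mkT p (pP : sublinear p /\ forall x, p x <= N x) : T := exist _ p pP.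
(* The order is reversed, so that a maximal element for [below] is a minimal functional. *)
pose below (p q : T) := `[< forall x, sval q x <= sval p x >].
have [| | | |[p [sp pN]] pmin] := @Zorn T below.
- by move=> t; apply/asboolP.
- move=> r s t /asboolP rs_ /asboolP st; apply/asboolP => x.
  exact: le_trans (st x) (rs_ x).
- move=> [s s1] [t t1] /asboolP /= st /asboolP /= ts.
  by apply: eq_exist; apply/funext => x; apply/eqP; rewrite eq_le ts st.
- move=> A Atot; have [[p0 Ap0]|A0] := pselect (A !=set0); last first.
    have NT : sublinear N /\ forall x, N x <= N x by [].
    by exists (mkT N NT) => s As; exfalso; apply: A0; exists s.
  pose E x : set R := [set sval p x | p in A].
  have Ei x : has_inf (E x).
    split; first by exists (sval p0 x), p0.
    exists (- N (- x)) => _ [p Ap <-]; have [sp pN] := svalP p.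
    by apply: le_trans (sublinear_ge _ sp); rewrite lerN2.
  have sE : sublinear (fun x => inf (E x)).
    apply: sublinear_inf => //.
    - move=> x y _ _ [p Ap <-] [q Aq <-].
      (* In a chain the smaller of [p] and [q] bounds the value at [x + y] by subadditivity. *)
      have [/asboolP pq|/asboolP qp] := Atot _ _ Ap Aq.
      + exists (sval q (x + y)); first by exists q.
        by apply: (le_trans ((svalP q).1.1 _ _)); rewrite lerD2r.
      + exists (sval p (x + y)); first by exists p.
        by apply: (le_trans ((svalP p).1.1 _ _)); rewrite lerD2l.
    - move=> r x _ r0 [p Ap <-]; exists (sval p (inc r *: x)); first by exists p.
      by rewrite (svalP p).1.2// ltW.
    - by exists p0 => //; rewrite sublinear0//; exact: (svalP p0).1.
    - by move=> _ [p Ap <-]; rewrite sublinear0//; exact: (svalP p).1.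
  have EN x : inf (E x) <= N x.
    apply: (@le_trans _ _ (sval p0 x)); last exact: (svalP p0).2.
    by apply: ge_inf; [exact: (Ei x).2|exists p0].
  exists (mkT (fun x => inf (E x)) (conj sE EN)) => p Ap; apply/asboolP => x /=.
  by apply: ge_inf; [exact: (Ei x).2|exists p].
exists p; split => // q sq qp.
have qN x : q x <= N x := le_trans (qp x) (pN x).
have := pmin (mkT q (conj sq qN)).
by move=> H; have /(congr1 sval) := H (asboolT qp).
Qed.

(** A minimal [u] is taken below the shift of [N] along [y0]. Minimality makes [u] odd, hence
    linear, and the shift gives u(-y0) <= -N(y0), which forces equality at [y0]. *)
Lemma hahn_banach_real (N : V -> R) (y0 : V) : sublinear N ->
  exists u : V -> R, [/\ forall r x y, u (inc r *: x + y) = r * u x + u y,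
    forall x, u x <= N x & u y0 = N y0].
Proof.
move=> sN; have [u [su uN umin]] := minimal_sublinear (sublinear_shiftP sN y0).
have uN' x : u x <= N x := le_trans (uN x) (sublinear_shift_le sN y0 x).
have uopp y : u (- y) = - u y.
  apply/eqP; rewrite eq_le; apply/andP; split.
    rewrite -{1}(umin _ (sublinear_shiftP su y) (sublinear_shift_le su y)).
    exact: sublinear_shiftN.
  by rewrite lerNl; exact: sublinear_ge.
have uD x y : u (x + y) = u x + u y.
  apply/eqP; rewrite eq_le su.1 /=.
  have := su.1 (x + y) (- y); rewrite addrK uopp; lra.
exists u; split => //.
- move=> r x y; rewrite uD; congr (_ + _).
  have [r0|/ltW r0] := leP 0 r; first exact: su.2.
  have := su.2 (- r) x; rewrite oppr_ge0 => /(_ r0).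
  by rewrite rmorphN scaleNr uopp mulNr => /oppr_inj.
- apply/eqP; rewrite eq_le uN'/=.
  by have := le_trans (uN (- y0)) (sublinear_shiftN sN y0); rewrite uopp lerN2.
Qed.

(** For fixed [x] the map z -> u(z x) is real-linear on the scalars, and its Riesz representative is
    [f x]. Over the complex numbers this is f(x) = u(x) - i u(i x). *)
Lemma real_functional_lift (u : V -> R) :
  (forall r x y, u (inc r *: x + y) = r * u x + u y) ->
  exists f : V -> K, (forall a x y, f (a *: x + y) = a * f x + f y) /\
    forall x, re (f x) = u x.
Proof.
move=> ul.
have /choice[f fE] x : exists c, forall z, u (z *: x) = re (z * c).
  apply: (re_riesz (g := fun z => u (z *: x))) => r z w.
  by rewrite scalerDl -scalerA ul.
exists f; split; last by move=> x; rewrite -[x]scale1r fE mul1r scale1r.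
have uD x y : u (x + y) = u x + u y.
  by have := ul 1 x y; rewrite rmorph1 scale1r mul1r.
move=> a x y; apply: re_inj => b.
by rewrite -fE scalerDr uD scalerA !fE mulrDr raddfD mulrA.
Qed.

End hahn_banach.

Lemma norming_functional (Y : normedModType K) (y0 : Y) :
  exists f : Y -> K, [/\ forall a x y, f (a *: x + y) = a * f x + f y,
    forall y, `|f y| <= `|y| & f y0 = `|y0|].
Proof.
pose N (y : Y) : R := re `|y|.
have sN : sublinear N.
  split => [x y|r x r0]; rewrite /N.
    by rewrite -raddfD; apply: re_le => //; exact: ler_normD.
  by rewrite normrZ norm_inc ger0_norm// reZ.
have [u [ul uN uy0]] := hahn_banach_real y0 sN.
have [f [fl fu]] := real_functional_lift ul.
have f0 : f 0 = 0.
  by have := fl (-1) 0 0; rewrite scaler0 addr0 mulN1r addNr.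
have fZ a x : f (a *: x) = a * f x.
  by have := fl a x 0; rewrite !addr0 f0 addr0.
have fle y : `|f y| <= `|y|.
  have [->|fy0] := eqVneq (f y) 0; first by rewrite normr0.
  rewrite [leLHS]ge0_inc// [leRHS]ge0_inc// inc_le.
  (* Rotating [y] by a unimodular scalar makes the value of [f] equal to |f y|, where the bound on
     the real part [u] applies. *)
  have -> : re `|f y| = u ((`|f y| / f y) *: y).
    by rewrite -fu fZ divfK.
  apply: (le_trans (uN _)); rewrite /N normrZ normf_div normr_id divff ?mul1r//.
  by rewrite normr_eq0.
have nf : `|f y0| = `|y0|.
  apply/eqP; rewrite eq_le fle/= [leLHS]ge0_inc// [leRHS]ge0_inc// inc_le.
  by rewrite (le_trans _ (re_le_norm rs _))// fu uy0.
have [f00|fy0] := eqVneq (f y0) 0.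
  by exists f; split => //; rewrite -nf f00 normr0.
(* The equality |f y0| = |y0| fixes only the modulus; a unimodular factor makes the value itself
   |y0|. *)
exists (fun y => `|f y0| / f y0 * f y); split.
- by move=> a x y; rewrite fl; ring.
- by move=> y; rewrite normrM normf_div normr_id divff ?normr_eq0// mul1r.
- by rewrite divfK.
Qed.

End real_structure_theory.

(** The order of [K] may be partial; nonnegativity makes [a] and [b] comparable, and e = (a - b)/2
    then refutes b < a. *)
Lemma le_of_le_addgt0 (K : numFieldType) (a b : K) :
  0 <= a -> 0 <= b -> (forall e, 0 < e -> a <= b + e) -> a <= b.
Proof.
move=> a0 b0 abe; rewrite real_leNgt ?ger0_real//; apply/negP => ba.
have e0 : 0 < (a - b) / 2%:R by rewrite divr_gt0 ?ltr0n// subr_gt0.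
have := abe _ e0.
have -> : b + (a - b) / 2%:R = (b + a) / 2%:R by field.
by move=> /le_lt_trans/(_ (midf_lt ba).2); rewrite ltxx.
Qed.

(** * Suprema and infima of nonnegative scalars *)

Section suprema.
Variables (R : realType) (K : numFieldType) (rs : real_structure R K).
Local Notation inc := (inc rs).
Local Notation re := (re rs).

(** Nonnegative scalars satisfy a = inc (re a), so the supremum can be taken in [R] and sent back by
    [inc]; the default value of [xget] is then not reached. *)
Lemma supK_sup (A : set K) M : A !=set0 -> (forall a, A a -> 0 <= a <= M) ->
  is_sup A (supK A).
Proof.
move=> A0 AM; rewrite /supK.
apply: (@xgetPex _ 0 [set s | is_sup A s]); exists (inc (sup (re @` A))).
have hs : has_sup (re @` A).
  split; first by case: A0 => a Aa; exists (re a), a.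
  exists (re M) => _ [a Aa <-]; have /andP[a0 aM] := AM _ Aa; exact: re_le.
have Ainc a : A a -> a = inc (re a) by move=> /AM/andP[a0 _]; exact: ge0_inc.
split => [a Aa|e e0].
  by rewrite (Ainc _ Aa) inc_le; apply: ub_le_sup; [exact: hs.2|exists a].
have [_ [a Aa <-] la] := sup_adherent (re_gt0 rs e0) hs.
exists a => //; rewrite (ge0_inc rs (ltW e0)) -rmorphB.
by rewrite (Ainc _ Aa) inc_lt.
Qed.

Lemma infK_inf (A : set K) : A !=set0 -> (forall a, A a -> 0 <= a) ->
  is_inf A (infK A).
Proof.
move=> A0 AM; rewrite /infK.
apply: (@xgetPex _ 0 [set s | is_inf A s]); exists (inc (inf (re @` A))).
have hs : has_inf (re @` A).
  split; first by case: A0 => a Aa; exists (re a), a.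
  by exists 0 => _ [a Aa <-]; apply: re_ge0; exact: AM.
have Ainc a : A a -> a = inc (re a) by move=> /AM a0; exact: ge0_inc.
split => [a Aa|e e0].
  by rewrite (Ainc _ Aa) inc_le; apply: ge_inf; [exact: hs.2|exists a].
have [_ [a Aa <-] la] := inf_adherent (re_gt0 rs e0) hs.
exists a => //; rewrite (ge0_inc rs (ltW e0)) -rmorphD.
by rewrite (Ainc _ Aa) inc_lt.
Qed.

Lemma is_sup_le (A : set K) s M : 0 <= M -> is_sup A s ->
  (forall a, A a -> a <= M) -> s <= M.
Proof.
move=> M0 [sA As] AM; have [a Aa _] := As 1 ltr01.
(* [s] is comparable with the member [a], and [a] with the nonnegative [M], so [s] is real and can
   be compared with [M]. *)
have sr : s \is Num.real.
  by rewrite -(ler_real (sA _ Aa)) (ler_real (AM _ Aa)) ger0_real.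
rewrite (real_leNgt sr (ger0_real M0)); apply/negP => Ms.
have [|b Ab] := As (s - M); first by rewrite subr_gt0.
by rewrite subKr => /lt_le_trans/(_ (AM _ Ab)); rewrite ltxx.
Qed.

Lemma is_inf_ge (A : set K) s M : 0 <= M -> is_inf A s ->
  (forall a, A a -> M <= a) -> M <= s.
Proof.
move=> M0 [sA As] AM; have [a Aa _] := As 1 ltr01.
have sr : s \is Num.real.
  by rewrite (ler_real (sA _ Aa)) -(ler_real (AM _ Aa)) ger0_real.
rewrite (real_leNgt (ger0_real M0) sr); apply/negP => sM.
have [|b Ab] := As (M - s); first by rewrite subr_gt0.
by rewrite addrC subrK => /(le_lt_trans (AM _ Ab)); rewrite ltxx.
Qed.

(** * Bounded operators and their linear combinations *)

Section unit_ball_bounds.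
Variables (V W : normedModType K).

Lemma unit_ball_sup (T : V -> W) :
  (exists M, forall x, `|T x| <= M * `|x|) ->
  is_sup [set `|T x| | x in [set x : V | `|x| <= 1]]
         (supK [set `|T x| | x in [set x : V | `|x| <= 1]]).
Proof.
move=> [M TM]; apply: (@supK_sup _ `|M|).
  by exists `|T 0|, 0 => //=; rewrite normr0.
move=> _ [x /= x1 <-]; rewrite normr_ge0/=.
apply: (le_trans (TM x)).
by rewrite -[leLHS]ger0_norm ?(le_trans _ (TM x))// normrM normr_id ler_piMr.
Qed.

Lemma opnorm_ge (T : V -> W) x : Lop T -> `|x| <= 1 -> `|T x| <= opnorm T.
Proof. by move=> [_ /unit_ball_sup[+ _]] x1; apply; exists x. Qed.

Lemma opnorm_ge0 (T : V -> W) : Lop T -> 0 <= opnorm T.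
Proof.
by move=> LT; apply: le_trans (opnorm_ge (x := 0) LT _); rewrite ?normr0.
Qed.

Lemma LopZ (T : V -> W) a x : Lop T -> T (a *: x) = a *: T x.
Proof.
move=> [Tl _]; have T0 : T 0 = 0.
  by have := Tl (-1) 0 0; rewrite scaler0 addr0 scaleN1r addNr.
by have := Tl a x 0; rewrite !addr0 T0 addr0.
Qed.

Lemma Lop_lin a (S T : V -> W) : Lop S -> Lop T -> Lop (fun x => a *: S x + T x).
Proof.
move=> [Sl [M SM]] [Tl [N TN]]; split.
  move=> b u v; rewrite Sl Tl !scalerDr !scalerA addrACA; congr (_ + _ + _).
  by rewrite mulrC.
exists (`|a| * M + N) => x.
rewrite (le_trans (ler_normD _ _))// mulrDl lerD// normrZ -mulrA.
exact: ler_wpM2l.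
Qed.

Lemma Lop0 : Lop (fun _ : V => 0 : W).
Proof.
split; first by move=> a u v; rewrite scaler0 addr0.
by exists 0 => x; rewrite normr0 mul0r.
Qed.

Lemma Lop_sum n (c : 'I_n -> K) (S : 'I_n -> V -> W) :
  (forall i, Lop (S i)) -> Lop (fun x => \sum_(i < n) c i *: S i x).
Proof.
elim: n c S => [|n IH] c S LS.
  have -> : (fun x => \sum_(i < 0) c i *: S i x) = (fun=> 0).
    by apply/funext => x; rewrite big_ord0.
  exact: Lop0.
have -> : (fun x => \sum_(i < n.+1) c i *: S i x) =
    (fun x => c ord0 *: S ord0 x + \sum_(i < n) c (lift ord0 i) *: S (lift ord0 i) x).
  by apply/funext => x; rewrite big_ord_recl.
by apply: Lop_lin => //; exact: IH.
Qed.

Lemma lin_on_L_sum (psi : (V -> W) -> K) n (c : 'I_n -> K) (S : 'I_n -> V -> W) :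
  lin_on_L psi -> (forall i, Lop (S i)) ->
  psi (fun x => \sum_(i < n) c i *: S i x) = \sum_(i < n) c i * psi (S i).
Proof.
move=> psil; elim: n c S => [|n IH] c S LS.
  rewrite big_ord0; have -> : (fun x => \sum_(i < 0) c i *: S i x) = (fun=> 0).
    by apply/funext => x; rewrite big_ord0.
  have := psil (-1) _ _ Lop0 Lop0; rewrite mulN1r addNr => <-.
  by congr psi; apply/funext => x; rewrite scaler0 addr0.
rewrite big_ord_recl -IH// -psil//; last exact: Lop_sum.
by congr psi; apply/funext => x; rewrite big_ord_recl.
Qed.

End unit_ball_bounds.

Lemma dual_sphere_le (Y : normedModType K) (f : Y -> K) y :
  dual_sphere f -> `|f y| <= `|y|.
Proof.
move=> [fl [fb f1]].
have [fs _] := @unit_ball_sup Y K^o f fb; rewrite -/(dnorm f) f1 in fs.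
have f0 : f 0 = 0.
  by have := fl (-1) 0 0; rewrite scaler0 addr0 mulN1r addNr.
have fZ a x : f (a *: x) = a * f x.
  by have := fl a x 0; rewrite !addr0 f0 addr0.
have [->|y0] := eqVneq y 0; first by rewrite f0 !normr0.
have : `|f (`|y|^-1 *: y)| <= 1.
  apply: fs; exists (`|y|^-1 *: y) => //=.
  by rewrite normrZ normfV normr_id mulVf// normr_eq0.
by rewrite fZ normrM normfV normr_id mulrC ler_pdivrMr ?mul1r// normr_gt0.
Qed.

(** The vector [z] guarantees that the dual sphere is nonempty; when [y = 0], any functional on that
    sphere has the required value 0. *)
Lemma dual_sphere_norming (Y : normedModType K) (y z : Y) : z != 0 ->
  exists2 f : Y -> K, dual_sphere f & f y = `|y|.
Proof.
have sphere (w : Y) : w != 0 -> exists2 f : Y -> K, dual_sphere f & f w = `|w|.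
  move=> w0; have [f [fl fle fw]] := norming_functional rs w.
  exists f => //; split=> //.
  have fb : exists M : K, forall y, `|f y| <= M * `|y|.
    by exists 1 => x; rewrite mul1r.
  split => //; have fs := @unit_ball_sup Y K^o f fb; rewrite -/(dnorm f) in fs.
  have d1 : 1 <= dnorm f.
    apply: fs.1; exists (`|w|^-1 *: w) => /=.
      by rewrite normrZ normfV normr_id mulVf// normr_eq0.
    have := fl `|w|^-1 w 0; rewrite addr0 => ->.
    have -> : f 0 = 0.
      by have := fl (-1) 0 0; rewrite scaler0 addr0 mulN1r addNr.
    by rewrite addr0 fw mulVf ?normr1// normr_eq0.
  apply/eqP; rewrite eq_le d1 andbT.
  apply: (is_sup_le ler01 fs) => _ [x /= x1 <-].
  exact: le_trans (fle x) x1.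
move=> z0; have [->|y0] := eqVneq y 0; last exact: sphere.
have [f fs _] := sphere _ z0; exists f => //; rewrite normr0.
by have := fs.1 (-1) 0 0; rewrite scaler0 addr0 mulN1r addNr.
Qed.

(** * The G-norm *)

Section gnorm.
Variables (X Y : normedModType K) (G : X -> Y).
Hypotheses (LG : bounded_linear G) (G1 : opnorm G = 1).

Lemma almost_norming_point d : 0 < d ->
  exists2 x, unit_sphere x & 1 - d < `|G x|.
Proof.
move=> d0; have [_ Gs] := unit_ball_sup LG.2; rewrite -/(opnorm G) G1 in Gs.
have d1 : 0 < 1 + d by rewrite addr_gt0.
(* With this margin |G x| exceeds 1/(1 + d), which is positive for every [d] and at least 1 - d. So
   [x] is nonzero, and normalising it can only increase |G x|. *)
have [|_ [x /= x1 <-]] := Gs (d / (1 + d)); first exact: divr_gt0.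
have -> : 1 - d / (1 + d) = (1 + d)^-1 by field; rewrite gt_eqF.
move=> Gx; have Gx0 : 0 < `|G x| by apply: lt_trans Gx; rewrite invr_gt0.
have x0 : x != 0.
  apply: contraTneq Gx0 => ->.
  by rewrite -(scale0r (0 : X)) (LopZ _ _ LG) scale0r normr0 ltxx.
exists (`|x|^-1 *: x).
  by rewrite /unit_sphere/= normrZ normfV normr_id mulVf// normr_eq0.
rewrite (LopZ _ _ LG) normrZ normfV normr_id.
apply: (@lt_le_trans _ _ `|G x|); last first.
  by rewrite ler_peMl// invf_ge1// normr_gt0.
apply: le_lt_trans Gx; rewrite -[leRHS]mul1r ler_pdivlMr//.
have -> : (1 - d) * (1 + d) = 1 - d * d by ring.
by rewrite gerBl mulr_ge0// ltW.
Qed.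

Let gset (T : X -> Y) (d : K) : set K :=
  [set `|T x| | x in [set x | unit_sphere x /\ 1 - d < `|G x|]].

Lemma gset_sup (T : X -> Y) d : Lop T -> 0 < d -> is_sup (gset T d) (supK (gset T d)).
Proof.
move=> LT d0; apply: (@supK_sup _ (opnorm T)).
  by have [x x1 Gx] := almost_norming_point d0; exists `|T x|, x.
by move=> _ [x [x1 _] <-]; rewrite normr_ge0 opnorm_ge// x1.
Qed.

Lemma gset_sup_ge0 (T : X -> Y) d : Lop T -> 0 < d -> 0 <= supK (gset T d).
Proof.
move=> LT d0; have [Ts _] := gset_sup LT d0.
have [x x1 Gx] := almost_norming_point d0.
by apply: (le_trans (normr_ge0 (T x))); apply: Ts; exists x.
Qed.

Lemma gnorm_inf T : Lop T ->
  is_inf [set supK (gset T d) | d in [set d : K | 0 < d]] (gnorm G T).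
Proof.
move=> LT; apply: infK_inf; first by exists (supK (gset T 1)), 1 => //=.
by move=> _ [d /= d0 <-]; exact: gset_sup_ge0.
Qed.

Lemma gnorm_ge0 T : Lop T -> 0 <= gnorm G T.
Proof.
move=> LT; apply: (is_inf_ge _ (gnorm_inf LT)) => // _ [d /= d0 <-].
exact: gset_sup_ge0.
Qed.

Lemma gnorm_le_opnorm T : Lop T -> gnorm G T <= opnorm T.
Proof.
move=> LT; apply: (@le_trans _ _ (supK (gset T 1))).
  by apply: (gnorm_inf LT).1; exists 1 => //=.
apply: (is_sup_le (opnorm_ge0 LT) (gset_sup LT ltr01)).
by move=> _ [x [x1 _] <-]; apply: opnorm_ge => //; rewrite x1.
Qed.

Lemma le_gnorm T c : Lop T -> 0 <= c ->
  (forall d e, 0 < d -> 0 < e ->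
    exists2 x, unit_sphere x /\ 1 - d < `|G x| & c <= `|T x| + e) ->
  c <= gnorm G T.
Proof.
move=> LT c0 cT; apply: (is_inf_ge c0 (gnorm_inf LT)) => _ [d /= d0 <-].
apply: le_of_le_addgt0 => // [|e e0]; first exact: gset_sup_ge0.
have [x xd cx] := cT _ _ d0 e0; apply: (le_trans cx).
by rewrite lerD2r; apply: (gset_sup LT d0).1; exists x.
Qed.

(** As an infimum, the G-norm is at most the supremum belonging to [d], and some |T x| comes within
    [d] of that supremum. *)
Lemma gnorm_adherent T d : Lop T -> 0 < d ->
  exists x, [/\ unit_sphere x, 1 - d < `|G x| & gnorm G T - d < `|T x|].
Proof.
move=> LT d0; have [_ [x [x1 Gx] <-] Tx] := (gset_sup LT d0).2 _ d0.
exists x; split => //; apply: le_lt_trans Tx; rewrite lerD2r.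
by apply: (gnorm_inf LT).1; exists d.
Qed.

End gnorm.

End suprema.

(** * Limits of bounded families along an ultrafilter *)

Section ultralimits.
Variables (R : realType) (K : numFieldType) (rs : real_structure R K).
Variables (I : Type) (U : set_system I) (UU : UltraFilter U).
Local Notation inc := (inc rs).
Local Notation re := (re rs).

Lemma ultra_cvg_real (u : I -> R) (M : R) : (forall i, `|u i| <= M) ->
  exists l : R, u i @[i --> U] --> l.
Proof.
move=> uM; pose E := [set r | U [set i | r <= u i]].
have hE : has_sup E.
  split; first by exists (- M); apply: (filterS _ filterT) => i _ /=;
    have := uM i; rewrite ler_norml => /andP[].
  exists M => r /filter_ex[i /= ri]; apply: (le_trans ri).
  exact: le_trans (ler_norm _) (uM i).
exists (sup E); apply/cvgrPdist_lt => e e0.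
have [r Er rE] := sup_adherent e0 hE.
(* The ultrafilter contains this set or its complement; the first case would put sup E + e/2 into
   [E]. *)
have [UE|UE] := in_ultra_setVsetC [set i | sup E + e / 2 <= u i] UU.
  by have := ub_le_sup hE.2 UE; rewrite leNgt ltrDl divr_gt0.
apply: filterS (filterI Er UE) => i [/= ri /negP]; rewrite -ltNge => ui.
by rewrite ltr_norml; lra.
Qed.

(** The real limits of re (z u_i) depend real-linearly on [z], so [re_riesz] gathers them into one
    scalar [l]. Convergence to [l] is tested on the multipliers 1 and [j] of [norm_le_re]. *)
Lemma ultra_cvg (u : I -> K) (M : K) : (forall i, `|u i| <= M) ->
  exists l : K, u i @[i --> U] --> l.
Proof.
move=> uM.
have absre z : `|re z| <= re `|z|.
  by rewrite ler_norml lerNl -raddfN -{1}normrN !re_le_norm.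
have /choice[g gP] z : exists l : R, re (z * u i) @[i --> U] --> l.
  apply: (@ultra_cvg_real _ (re (`|z| * M))) => i.
  apply: (le_trans (absre _)); apply: re_le => //.
  by rewrite normrM ler_wpM2l.
have [l lP] : exists l, forall z, g z = re (z * l).
  apply: re_riesz => r z w.
  apply: (cvg_unique (@norm_hausdorff _ R^o) (gP _)).
  have -> : (fun i => re ((inc r * z + w) * u i)) =
      (fun i => r * re (z * u i)) \+ (fun i => re (w * u i)).
    by apply/funext => i /=; rewrite mulrDl raddfD -mulrA reZ.
  by apply: cvgD => //; apply: cvgMl_tmp.
have [j jP] := norm_le_re rs.
exists l; apply/cvgrPdist_lt => e e0.
have e2 : 0 < re e / 2 by rewrite divr_gt0// re_gt0.
have H z : U [set i | `|re (z * (l - u i))| < re e / 2].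
  have /cvgrPdist_lt/(_ _ e2) := gP z.
  by apply: filterS => i /=; rewrite lP mulrBr raddfB.
apply: filterS (filterI (H 1) (H j)) => i [/= h1 h2].
rewrite (normE rs) (ge0_inc rs (ltW e0)) inc_lt.
by apply: (le_lt_trans (jP _)); rewrite mul1r in h1; lra.
Qed.

(* An ultrafilter as a net: pairs of a member and a point of it, ordered by
   reverse inclusion of the members. *)
Definition ultra_index := {p : set I * I | U p.1 /\ p.1 p.2}.
Definition ultra_le (p q : ultra_index) := (sval q).1 `<=` (sval p).1.

Lemma ultra_point A : U A -> exists p : ultra_index, (sval p).1 = A.
Proof.
by move=> UA; have [i Ai] := filter_ex UA; exists (exist _ (A, i) (conj UA Ai)).
Qed.

Lemma ultra_directed : directed_le ultra_le.
Proof.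
split; first by have [p _] := ultra_point filterT; exists p.
split; first by move=> p.
split; first by move=> p q r pq qr; exact: subset_trans qr pq.
move=> p q.
have [r rE] := ultra_point (filterI (svalP p).1 (svalP q).1).
by exists r; rewrite /ultra_le rE; split; [exact: subIsetl|exact: subIsetr].
Qed.

Lemma ultra_net_cvg (u : I -> K) (l : K) : u i @[i --> U] --> l ->
  net_cvg ultra_le (fun p => u (sval p).2) l.
Proof.
move=> /cvgrPdist_lt ul e /ul /ultra_point[p pE].
exists p => q qp; have := qp _ (svalP q).2.
by rewrite pE /= distrC.
Qed.

End ultralimits.

(** * The set C is bounded by the G-norm and norms it *)

Section norming_C.
Variables (R : realType) (K : numFieldType) (rs : real_structure R K).
Variables (X Y : normedModType K) (G : X -> Y).
Hypotheses (LG : bounded_linear G) (G1 : opnorm G = 1).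
Local Notation inc := (inc rs).
Local Notation re := (re rs).

Lemma Cset_le_gnorm phi T : Cset G phi -> Lop T -> `|phi T| <= gnorm G T.
Proof.
move=> [_ [I [le [x [y [[_ [_ [letr dir]]] xy Gx phiT]]]]]] LT.
apply: (le_gnorm rs LG G1) => // d e d0 e0.
have [i iP] := Gx _ d0; have [j jP] := phiT T LT _ e0.
have [k [ik jk]] := dir i j; have [xk yk] := xy k.
exists (x k).
  split => //; have := iP _ ik; rewrite real_ltr_distl; first by case/andP.
  by rewrite rpredB// ?normr_real// rpred1.
have := jP _ jk; rewrite /psi_xy distrC => /ltW Tk.
rewrite -[phi T](subrK (y k (T (x k)))) addrC.
apply: (le_trans (ler_normD _ _)); rewrite lerD//.
exact: (dual_sphere_le rs).
Qed.

Lemma Cset_norming S : Lop S -> exists2 phi, Cset G phi & re (gnorm G S) <= re (phi S).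
Proof.
move=> LS; pose d (n : nat) : K := inc n.+1%:R^-1.
have d0 n : 0 < d n by rewrite -[0](rmorph0 inc) inc_lt invr_gt0 ltr0n.
have /choice[xy xyP] n : exists p : X * (Y -> K),
    [/\ unit_sphere p.1, 1 - d n < `|G p.1|, gnorm G S - d n < `|S p.1|,
        dual_sphere p.2 & p.2 (S p.1) = `|S p.1|].
  have [x [x1 Gx Sx]] := gnorm_adherent rs LG G1 LS (d0 n).
  (* The margin 1 gives |G x'| > 0, a nonzero vector of [Y], so that a norming functional exists
     even when S x = 0. *)
  have [x' x'1 Gx'] := almost_norming_point rs LG G1 (@ltr01 K).
  have Gx'0 : G x' != 0 by rewrite -normr_gt0; rewrite subrr in Gx'.
  have [f fs fS] := dual_sphere_norming rs (S x) Gx'0.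
  by exists (x, f).
(* [U] refines the filter at infinity, so [d n] tends to 0 along it. *)
have [U [UU ooU]] := @ultraFilterLemma nat \oo _.
pose ev T n := (xy n).2 (T (xy n).1).
have ev_le T n : Lop T -> `|ev T n| <= opnorm T.
  move=> LT; have [x1 _ _ fs _] := xyP n.
  apply: (le_trans (dual_sphere_le rs _ fs)).
  by apply: (opnorm_ge rs) => //; rewrite x1.
pose phi T : K := lim (ev T n @[n --> U]).
have phiP T : Lop T -> ev T n @[n --> U] --> phi T.
  move=> LT; have [l lP] := ultra_cvg rs UU (fun n => ev_le T n LT).
  by apply/cvg_ex; exists l.
have dU e : 0 < e -> U [set n | d n < e].
  move=> e0; apply: ooU; have re0 := re_gt0 rs e0.
  have := near_infty_natSinv_lt (PosNum re0); apply: filterS => n /=.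
  by move=> ne; rewrite (ge0_inc rs (ltW e0)) inc_lt.
have phi_ball : dual_ball phi.
  split.
    move=> a T1 T2 L1 L2; apply: cvg_lim; first exact: norm_hausdorff.
    have -> : ev (fun x => a *: T1 x + T2 x) = (fun n => a * ev T1 n) \+ ev T2.
      by apply/funext => n; rewrite /ev /=; have [_ _ _ [-> _] _] := xyP n.
    by apply: cvgD; [apply: cvgMl_tmp|]; exact: phiP.
  move=> T LT; apply: le_of_le_addgt0 => //; first exact: (opnorm_ge0 rs).
  move=> e e0; have /cvgrPdist_lt/(_ _ e0)/filter_ex[n /= Tn] := phiP _ LT.
  rewrite -[phi T](subrK (ev T n)) addrC.
  by apply: (le_trans (ler_normD _ _)); rewrite lerD// ?ev_le// ltW.
exists phi.
  split => //.
  exists (ultra_index U), (@ultra_le _ U), (fun p => (xy (sval p).2).1),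
    (fun p => (xy (sval p).2).2); split.
  - exact: ultra_directed.
  - by move=> p; have [] := xyP (sval p).2.
  - apply: (@ultra_net_cvg _ _ _ UU (fun n => `|G (xy n).1|)).
    apply/cvgrPdist_lt => e e0; apply: filterS (dU _ e0) => n /= dn.
    have [x1 Gx _ _ _] := xyP n.
    have Gx1 : `|G (xy n).1| <= 1 by rewrite -G1; apply: (opnorm_ge rs) => //; rewrite x1.
    by rewrite ger0_norm ?subr_ge0// (lt_trans _ dn)// ltrBlDr -ltrBlDl.
  - by move=> T LT; exact: ultra_net_cvg (phiP _ LT).
apply/ler_addgt0Pr => e e0; have e2 : 0 < inc (e / 2).
  by rewrite -[0](rmorph0 inc) inc_lt divr_gt0.
have /cvgrPdist_lt/(_ _ e2) Sn := phiP _ LS.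
(* One index [n] is good for both estimates: |S x_n| is within e/2 of phi(S), and it exceeds the
   G-norm of [S] minus e/2. *)
have [n /= [{}Sn dn]] := filter_ex (@filterI _ U _ _ _ Sn (dU _ e2)).
have [_ _ Sx _ evS] := xyP n; rewrite /ev evS in Sn.
have h1 : re (gnorm G S) <= re `|S (xy n).1| + e / 2.
  rewrite -[e / 2](incK rs) -raddfD; apply: re_le.
    exact: (gnorm_ge0 rs LG G1).
  by rewrite -lerBlDr (le_trans _ (ltW Sx))// lerD2l lerN2 ltW.
have h2 : re `|S (xy n).1| - re (phi S) <= e / 2.
  rewrite -raddfB (le_trans (re_le_norm _ _))// -[e / 2](incK rs).
  by apply: re_le => //; rewrite distrC ltW.
lra.
Qed.

End norming_C.

(** * Separating a bounded convex set from the origin in K^n *)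

Section separation.
Variables (R : realType) (K : numFieldType) (rs : real_structure R K) (n : nat).
Local Notation inc := (inc rs).
Local Notation re := (re rs).
Local Notation cj := (cj rs).
Implicit Types v w : 'I_n -> K.

(** The real part of the standard inner product, which makes K^n a real Euclidean space. *)
Definition re_dot v w : R := re (\sum_i cj (v i) * w i).

Lemma re_dotE v w : re_dot v w = \sum_i re (cj (v i) * w i).
Proof. exact: raddf_sum. Qed.

Lemma re_dotC v w : re_dot v w = re_dot w v.
Proof. by rewrite !re_dotE; apply: eq_bigr => i _; exact: re_cjC. Qed.

Lemma re_dotDr v w r w' :
  re_dot v (fun i => w i + inc r * w' i) = re_dot v w + r * re_dot v w'.
Proof.
rewrite !re_dotE mulr_sumr -big_split; apply: eq_bigr => i _ /=.
by rewrite mulrDr raddfD mulrCA reZ.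
Qed.

Lemma re_dot_sqr v : re_dot v v = \sum_i re `|v i| ^+ 2.
Proof. by rewrite re_dotE; apply: eq_bigr => i _; exact: re_cj_norm. Qed.

Lemma re_dot_segment v w t :
  let vt := fun i => v i + inc t * (w i - v i) in
  let d := fun i => w i - v i in
  re_dot vt vt = re_dot v v + 2 * t * re_dot v d + t ^+ 2 * re_dot d d.
Proof.
move=> vt d; rewrite {2}/vt (re_dotDr vt v t d) (re_dotC vt v) (re_dotC vt d).
rewrite /vt (re_dotDr v v t d) (re_dotDr d v t d) (re_dotC d v); ring.
Qed.

(* An approximate minimiser [v] of the square distance to the origin already
   separates: moving from [v] towards [w] in [D] by a small fixed ratio [t]
   decreases the square norm by almost [2 t <v, v - w>], which must stay below
   the defect of [v]. So neither closedness nor a limit point is needed. *)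
Lemma convex_separation (D : set ('I_n -> K)) (b : 'I_n -> K) (e : K) :
  D !=set0 ->
  (forall v w t, D v -> D w -> 0 <= t <= 1 ->
    D (fun i => v i + inc t * (w i - v i))) ->
  (forall v i, D v -> `|v i| <= b i) ->
  0 < e -> (forall v, D v -> exists i, e <= `|v i|) ->
  exists c, forall w, D w -> 0 < re (\sum_i c i * w i).
Proof.
move=> D0 Dconv Db e0 De.
pose F := [set re_dot v v | v in D].
have Fe v : D v -> re e ^+ 2 <= re_dot v v.
  move=> Dv; have [i ei] := De _ Dv.
  rewrite re_dot_sqr (bigD1 i)//=.
  apply: ler_wpDr; first by apply: sumr_ge0 => j _; exact: sqr_ge0.
  by rewrite ler_sqr ?nnegrE ?re_ge0 ?(ltW e0)//; apply: re_le => //; exact: ltW.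
have hF : has_inf F.
  split; first by case: D0 => v Dv; exists (re_dot v v), v.
  by exists (re e ^+ 2) => _ [v Dv <-]; exact: Fe.
pose m := inf F.
have m0 : 0 < m.
  apply: (@lt_le_trans _ _ (re e ^+ 2)); first by rewrite exprn_gt0// re_gt0.
  by apply: lb_le_inf; [exact: hF.1|move=> _ [v Dv <-]; exact: Fe].
(* [B] bounds the squared diameter of [D]. *)
pose B := \sum_i re (b i + b i) ^+ 2.
have B0 : 0 <= B by apply: sumr_ge0 => i _; exact: sqr_ge0.
have DB v w : D v -> D w -> re_dot (fun i => w i - v i) (fun i => w i - v i) <= B.
  move=> Dv Dw; rewrite re_dot_sqr; apply: ler_sum => i _.
  have h : `|w i - v i| <= b i + b i.
    by rewrite (le_trans (ler_normB _ _))// lerD// Db.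
  by rewrite ler_sqr ?nnegrE ?re_ge0 ?(le_trans _ h)//; exact: re_le.
have mB : 0 < m + 2 * B by rewrite ltr_wpDr// mulr_ge0.
(* This ratio satisfies both t <= 1 and t B <= m/2. *)
pose t := m / (m + 2 * B).
have t0 : 0 < t by rewrite divr_gt0.
have t1 : t <= 1 by rewrite ler_pdivrMr// mul1r lerDl mulr_ge0.
have tB : t * B <= m / 2.
  rewrite /t mulrAC ler_pdivrMr//; nra.
have eta0 : 0 < t * m / 2 by rewrite divr_gt0// mulr_gt0.
have [_ [v Dv <-] vm] := inf_adherent eta0 hF; rewrite -/m in vm.
exists (fun i => cj (v i)) => w Dw; rewrite -/(re_dot v w).
have t01 : 0 <= t <= 1 by rewrite ltW.
have : m <= re_dot (fun i => v i + inc t * (w i - v i)) (fun i => v i + inc t * (w i - v i)).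
  by apply: ge_inf; [exact: hF.2|exists (fun i => v i + inc t * (w i - v i)) => //; exact: Dconv].
rewrite re_dot_segment => mt.
have vw : re_dot v (fun i => w i - v i) = re_dot v w - re_dot v v.
  have := re_dotDr v w (-1) v; rewrite mulN1r => <-.
  by congr re_dot; apply/funext => i; rewrite rmorphN rmorph1 mulN1r.
rewrite vw in mt.
have mv : m <= re_dot v v by apply: ge_inf; [exact: hF.2|exists v].
have := DB _ _ Dv Dw.
move: mt; set q := re_dot (fun i => w i - v i) (fun i => w i - v i) => mt qB.
have tqB : t ^+ 2 * q <= t * (m / 2).
  by rewrite expr2 -mulrA (ler_wpM2l (ltW t0))// (le_trans _ tB)// (ler_wpM2l (ltW t0)).
(* In m <= |v|^2 + 2t(<v,w> - |v|^2) + t^2 q, the bounds m <= |v|^2 < m + tm/2 and t^2 q <= tm/2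
   leave 2t<v,w> > tm. *)
have : 0 < t * re_dot v w; last by rewrite pmulr_rgt0.
have tm0 : 0 < t * m by exact: mulr_gt0.
have tmv : t * m <= t * re_dot v v by rewrite (ler_wpM2l (ltW t0)).
lra.
Qed.

End separation.

(** * The two inclusions *)

Section dual_ball.
Variables (R : realType) (K : numFieldType) (rs : real_structure R K).
Variables (X Y : normedModType K) (G : X -> Y).
Hypotheses (LG : bounded_linear G) (G1 : opnorm G = 1).
Local Notation inc := (inc rs).
Local Notation re := (re rs).

Lemma conv_hull_sub (A : set ((X -> Y) -> K)) phi : A phi -> conv_hull A phi.
Proof.
move=> Aphi; exists 1%N, (fun=> 1), (fun=> phi); split => //.
  by rewrite big_ord1.
by apply/funext => S; rewrite big_ord1 mul1r.
Qed.

(** The two families are concatenated over ['I_(n + m)], with weights scaled by 1 - t and t. *)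
Lemma conv_hull_segment (A : set ((X -> Y) -> K)) phi psi t :
  conv_hull A phi -> conv_hull A psi -> 0 <= t <= 1 ->
  conv_hull A (fun S => phi S + inc t * (psi S - phi S)).
Proof.
move=> [n [lam [f [lam0 lam1 Af ->]]]] [m [mu [g [mu0 mu1 Ag ->]]]] /andP[t0 t1].
pose glue T (u : 'I_n -> T) (v : 'I_m -> T) (k : 'I_(n + m)) :=
  match fintype.split k with inl i => u i | inr j => v j end.
have glueL T u v i : @glue T u v (lshift m i) = u i.
  by rewrite /glue (unsplitK (inl i)).
have glueR T u v j : @glue T u v (rshift n j) = v j.
  by rewrite /glue (unsplitK (inr j)).
exists (n + m)%N, (glue _ (fun i => (1 - inc t) * lam i) (fun j => inc t * mu j)),
  (glue _ f g); split.
- move=> k; rewrite /glue; case: (fintype.split k) => i; rewrite mulr_ge0//.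
    by rewrite -(rmorph1 inc) -rmorphB inc_ge0// subr_ge0.
  exact: inc_ge0.
- rewrite big_split_ord /=.
  under eq_bigr do rewrite glueL.
  under [X in _ + X]eq_bigr do rewrite glueR.
  by rewrite -!mulr_sumr lam1 mu1 !mulr1 subrK.
- by move=> k; rewrite /glue; case: (fintype.split k).
apply/funext => S; rewrite big_split_ord /=.
under [X in _ = X + _]eq_bigr do rewrite !glueL -mulrA.
under [X in _ = _ + X]eq_bigr do rewrite !glueR -mulrA.
rewrite -!mulr_sumr; ring.
Qed.

Lemma conv_hull_Cset_le phi T :
  conv_hull (Cset G) phi -> Lop T -> `|phi T| <= gnorm G T.
Proof.
move=> [n [lam [f [lam0 lam1 Cf ->]]]] LT.
apply: (le_trans (ler_norm_sum _ _ _)).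
rewrite -[leRHS]mul1r -lam1 mulr_suml; apply: ler_sum => i _.
by rewrite normrM ger0_norm// ler_wpM2l// (Cset_le_gnorm rs).
Qed.

Lemma wstar_closure_sub_dual_ball :
  wstar_closure (conv_hull (Cset G)) `<=` dual_ball_G G.
Proof.
move=> psi [[psil _] psiC]; split => // S LS.
apply: le_of_le_addgt0 => //; first exact: (gnorm_ge0 rs LG G1).
move=> e e0; have [phi Cphi] := psiC 1%N (fun=> S) e (fun=> LS) e0.
move=> /(_ ord0); rewrite distrC => h.
rewrite -[psi S](subrK (phi S)) addrC.
apply: (le_trans (ler_normD _ _)); rewrite lerD//; last exact: ltW.
exact: conv_hull_Cset_le.
Qed.

Lemma dual_ball_sub_wstar_closure :
  dual_ball_G G `<=` wstar_closure (conv_hull (Cset G)).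
Proof.
move=> psi [psil psiG]; split.
  split => //; exists 1 => S LS; rewrite mul1r.
  exact: le_trans (psiG _ LS) (gnorm_le_opnorm rs LG G1 LS).
move=> n S e LS e0; apply: contrapT => far.
(* Evaluation at the [S i], translated so that [psi] goes to the origin: by [far], every point of
   the image of co(C) has a coordinate of modulus at least [e]. *)
pose v (phi : (X -> Y) -> K) i := phi (S i) - psi (S i).
have [||||c cP] := convex_separation (rs := rs) (D := v @` conv_hull (Cset G))
    (b := fun i => gnorm G (S i) + gnorm G (S i)) _ _ _ e0.
- have [phi Cphi _] := Cset_norming rs LG G1 LG.
  by exists (v phi), phi => //; exact: conv_hull_sub.
- move=> _ _ t [phi Cphi <-] [phi' Cphi' <-] t01.
  exists (fun T => phi T + inc t * (phi' T - phi T)).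
    exact: conv_hull_segment.
  by apply/funext => i; rewrite /v; ring.
- move=> _ i [phi Cphi <-]; rewrite /v (le_trans (ler_normB _ _))//.
  by apply: lerD; [exact: conv_hull_Cset_le|exact: psiG].
- move=> _ [phi Cphi <-]; apply: contrapT => near_psi.
  apply: far; exists phi => // i; rewrite (real_ltNge (normr_real _) (gtr0_real e0)).
  by apply/negP => ei; apply: near_psi; exists i.
(* The minus sign turns the separation into re (phi T) < re (psi T) on co(C). *)
pose T x := \sum_(i < n) - c i *: S i x.
have LT : Lop T by exact: Lop_sum.
have [phi Cphi phiT] := Cset_norming rs LG G1 LT.
have : 0 < re (\sum_i c i * v phi i).
  by apply: cP; exists phi => //; exact: conv_hull_sub.
have -> : \sum_i c i * v phi i = psi T - phi T.
  rewrite /T !lin_on_L_sum//; last by have [[]] := Cphi.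
  by rewrite -sumrB; apply: eq_bigr => i _; rewrite /v; ring.
rewrite raddfB subr_gt0 ltNge => /negP; apply; apply: le_trans phiT.
apply: (le_trans (re_le_norm _ _)); apply: re_le => //; exact: psiG.
Qed.

Lemma dual_ball_GE : dual_ball_G G = wstar_closure (conv_hull (Cset G)).
Proof.
apply/seteqP; split.
  exact: dual_ball_sub_wstar_closure.
exact: wstar_closure_sub_dual_ball.
Qed.

End dual_ball.

(* K = R (first conjunct) and K = C = R[i] (second conjunct) *)
Theorem theorem3p8 (R : realType) :
  (forall (X Y : completeNormedModType R) (G : X -> Y),
     bounded_linear G -> opnorm G = 1 -> gnorm_is_norm G ->
     dual_ball_G G = wstar_closure (conv_hull (Cset G))) /\
  (forall (X Y : completeNormedModType R[i]) (G : X -> Y),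
     bounded_linear G -> opnorm G = 1 -> gnorm_is_norm G ->
     dual_ball_G G = wstar_closure (conv_hull (Cset G))).
Proof.
split => X Y G LG G1 _.
  exact: (dual_ball_GE (real_structure_real R)).
exact: (dual_ball_GE (real_structure_complex R)).
Qed.
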